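(* For every real number $\alpha \ge 1$ there exists an instance $(G,\mathcal{S})$ of \textsc{MinSum Retrieval} such that: (i) $G$ is a directed path; (ii) $G$ has a single weight function, namely $s_e = r_e$ for every edge $e$; (iii) the triangle inequality holds; and the solution returned by the algorithm \textsf{LMG} on $(G,\mathcal{S})$ has total retrieval cost strictly larger than $\alpha$ times the optimal total retrieval cost of \textsc{MinSum Retrieval} on $(G,\mathcal{S})$ (this optimum being positive). In other words, \textsf{LMG} has no bounded approximation factor for \textsc{MinSum Retrieval}, even under assumptions (i)–(iii).
   Context: A version graph is a directed graph $G=(V,E)$ in which every vertex (version) $v$ has a materialization (storage) cost $s_v\in\mathbb{N}$ and every edge (delta) $e=(u,v)$ has a storage cost $s_e\in\mathbb{N}$ and a retrieval cost $r_e\in\mathbb{N}$. A solution consists of a set $M\subseteq V$ of materialized vertices and a set $F\subseteq E$ of stored edges such that every vertex is reachable from some vertex of $M$ by a directed path (possibly of length $0$) using only edges of $F$. Its storage cost is $\sum_{v\in M}s_v+\sum_{e\in F}s_e$; the retrieval cost $R(v)$ of a vertex $v$ is the minimum, over such paths from a vertex of $M$ to $v$ with all edges in $F$, of the sum of $r_e$ along the path (so $R(v)=0$ if $v\in M$). \textsc{MinSum Retrieval}: given $G$ and a storage bound $\mathcal{S}$, find a solution of storage cost at most $\mathcal{S}$ minimizing $\sum_{v\in V}R(v)$. The triangle inequality means: $r_{u,v}\le r_{u,w}+r_{w,v}$ and $s_{u,v}\le s_{u,w}+s_{w,v}$ whenever the three edges exist, and $s_u+s_{u,v}\ge s_v$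 for every edge $(u,v)$. The algorithm \textsf{LMG} (Local Move Greedy): form $G_{aux}$ by adding a new vertex $v_{aux}$ and, for each $v\in V$, an edge $(v_{aux},v)$ with retrieval cost $0$ and storage cost $s_v$. Arborescences $T$ of $G_{aux}$ rooted at $v_{aux}$ correspond to solutions (edge $(v_{aux},v)\in T$ means $v$ is materialized; other edges of $T$ are stored); $S(T)$ is the sum of storage costs of edges of $T$, $R_T(v)$ the sum of retrieval costs on the $v_{aux}$–$v$ path in $T$, and $P(v)$ the parent of $v$ in $T$. Start with $T$ a minimum-storage arborescence of $G_{aux}$ rooted at $v_{aux}$. While $S(T)<\mathcal{S}$: for every not-yet-materialized vertex $v$ with $S(T)+s_v-s_{P(v),v}\le\mathcal{S}$, let $T'$ be $T$ with $(P(v),v)$ replaced by $(v_{aux},v)$ and compute the ratio $\rho(v)=\big(\sum_w R_T(w)-\sum_w R_{T'}(w)\big)/(s_v-s_{P(v),v})$; replace $T$ by $T'$ for a vertex $v$ of maximum positive ratio (stop if there is no such vertex or all vertices are materialized). Output $T$. *)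

(* Defs.v *)
From HB Require Import structures.
From mathcomp Require Import all_boot all_order all_algebra.
From mathcomp Require Import boolp reals constructive_ereal.

Set Implicit Arguments.
Unset Strict Implicit.
Unset Printing Implicit Defensive.

Import Order.TTheory GRing.Theory Num.Theory.
Local Open Scope ring_scope.

(* Least element of a set of naturals; the value 0 for the empty set is a
   dummy. *)
Definition natmin (P : nat -> Prop) : nat :=
  if pselect (exists c, `[< P c >]) is left exP then ex_minn exP else 0%N.

(* The edge costs are only meaningful on pairs satisfying [edge]. *)
Record version_graph := VersionGraph {
  vertex :> finType;
  edge : rel vertex;
  mat_cost : vertex -> nat;
  store_cost : vertex -> vertex -> nat;
  retr_cost : vertex -> vertex -> nat
}.

Section Assumptions.
Variable G : version_graph.

Definition is_directed_path : Prop :=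
  exists (n : nat) (f : 'I_n.+1 -> G),
    bijective f /\ forall i j, edge (f i) (f j) = (j == i.+1 :> nat).

Definition single_weight : Prop :=
  forall u v : G, edge u v -> store_cost u v = retr_cost u v.

Definition triangle_inequality : Prop :=
  (forall u v w : G, edge u v -> edge u w -> edge w v ->
     (retr_cost u v <= retr_cost u w + retr_cost w v)%N /\
     (store_cost u v <= store_cost u w + store_cost w v)%N) /\
  (forall u v : G, edge u v -> (mat_cost v <= mat_cost u + store_cost u v)%N).

End Assumptions.

Section MinSumRetrieval.
Variable G : version_graph.

Record solution := Solution {
  materialized : {set G};
  stored : {set G * G}
}.

(* [m :: p] is the vertex sequence of a path of stored edges from the
   materialized vertex [m] to [v]. *)
Definition retrieval_path (X : solution) (m : G) (p : seq G) (v : G) : Prop :=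
  [/\ m \in materialized X,
      path (fun x y => (x, y) \in stored X) m p
    & last m p = v].

Definition valid_solution (X : solution) : Prop :=
  (forall e, e \in stored X -> edge e.1 e.2) /\
  (forall v, exists m p, retrieval_path X m p v).

Definition solution_storage (X : solution) : nat :=
  (\sum_(v in materialized X) mat_cost v
   + \sum_(e in stored X) store_cost e.1 e.2)%N.

Definition path_retrieval (m : G) (p : seq G) : nat :=
  sumn (pairmap (@retr_cost G) m p).

Definition retrieval (X : solution) (v : G) : nat :=
  natmin (fun c => exists m p, retrieval_path X m p v /\ c = path_retrieval m p).

Definition total_retrieval (X : solution) : nat :=
  (\sum_(v : G) retrieval X v)%N.

(* Only meaningful when some valid solution satisfies the storage bound; the
   dummy value is 0 otherwise. *)
Definition opt_retrieval (S : nat) : nat :=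
  natmin (fun c => exists X, [/\ valid_solution X, (solution_storage X <= S)%N
                               & c = total_retrieval X]).

End MinSumRetrieval.

Section LMG.
Variable G : version_graph.

(* The vertices of the auxiliary graph are [option G], with [None] for v_aux;
   no edge enters [None]. *)
Definition aux_edge (x : option G) (v : G) : bool :=
  if x is Some u then edge u v else true.
Definition aux_store (x : option G) (v : G) : nat :=
  if x is Some u then store_cost u v else mat_cost v.
Definition aux_retr (x : option G) (v : G) : nat :=
  if x is Some u then retr_cost u v else 0%N.

(* A spanning arborescence rooted at v_aux is represented by its parent map:
   its edges are the pairs [(T v, Some v)]. *)
Definition parent_map := {ffun G -> option G}.

Implicit Type T : parent_map.

(* The [k]-th ancestor of [v], remaining at v_aux once it has been reached. *)
Definition ancestor T (k : nat) (v : G) : option G :=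
  iter k (obind T) (Some v).

Definition arborescence T : Prop :=
  (forall v, aux_edge (T v) v) /\
  (forall v, exists k, ancestor T k v = None).

Definition tree_storage T : nat := (\sum_v aux_store (T v) v)%N.

(* In an arborescence the path from v_aux to [v] consists of the edges entering
   the successive ancestors of [v], of which at most [#|G|] differ from
   v_aux. *)
Definition tree_retrieval T (v : G) : nat :=
  (\sum_(k < #|G|)
     if ancestor T k v is Some w then aux_retr (T w) w else 0)%N.

Definition tree_total_retrieval T : nat := (\sum_v tree_retrieval T v)%N.

Definition min_storage_arborescence T : Prop :=
  arborescence T /\
  forall T', arborescence T' -> (tree_storage T <= tree_storage T')%N.

Definition solution_of_tree T : solution G :=
  Solution [set v | T v == None] [set e | T e.2 == Some e.1].

Definition materialize T (v : G) : parent_map :=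
  [ffun w => if w == v then None else T w].

(* A positive gain at zero additional storage has ratio [+oo]. *)
Definition lmg_ratio T (v : G) : \bar rat :=
  let gain : rat := (tree_total_retrieval T)%:R
                    - (tree_total_retrieval (materialize T v))%:R in
  let extra : rat := (mat_cost v)%:R - (aux_store (T v) v)%:R in
  if extra == 0 then (if 0 < gain then +oo%E else 0%:E)
  else (gain / extra)%:E.

(* The subtraction is not truncated: [aux_store (T v) v] is a summand of
   [tree_storage T]. *)
Definition lmg_candidate (S : nat) T (v : G) : bool :=
  (T v != None) &&
  (tree_storage T + mat_cost v - aux_store (T v) v <= S)%N.

Definition lmg_step (S : nat) T T' : Prop :=
  (tree_storage T < S)%N /\
  exists v, [/\ lmg_candidate S T v,
                (0 < lmg_ratio T v)%E,
                forall w, lmg_candidate S T w ->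
                  (lmg_ratio T w <= lmg_ratio T v)%E
              & T' = materialize T v].

Inductive lmg_run (S : nat) : parent_map -> parent_map -> Prop :=
| lmg_stop T : (forall T', ~ lmg_step S T T') -> lmg_run S T T
| lmg_continue T T' T'' :
    lmg_step S T T' -> lmg_run S T' T'' -> lmg_run S T T''.

(* A relation rather than a function, since the algorithm does not specify how
   ties are broken, neither for the initial arborescence nor among vertices of
   maximum ratio. *)
Definition lmg_output (S : nat) T : Prop :=
  exists2 T0, min_storage_arborescence T0 & lmg_run S T0 T.

End LMG.

(* Main.v *)
Require Import Defs.
From mathcomp Require Import all_boot all_order all_algebra.
From mathcomp Require Import boolp reals constructive_ereal.
From mathcomp Require Import zify ring lra.

Import Order.TTheory GRing.Theory Num.Theory.
Local Open Scope ring_scope.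

(** The bad instance is the path [0 -> 1 -> 2] with materialization costs
    [1, N, N^2], delta costs [N - 1] and [N^2 - N], and storage bound
    [1 + (N - 1) + N^2].  The minimum-storage tree materializes only [0].
    Materializing [1] has ratio [2 (N - 1)], materializing [2] only
    [(N^2 - 1) / N], so LMG picks [1]; then [2] is too expensive by one unit
    and the retrieval cost stays at [N^2 - N].  Materializing [2] instead is
    affordable and has retrieval cost [N - 1], smaller by a factor [N]. *)

(** * Minima of sets of naturals *)

Section NatMin.
Local Open Scope nat_scope.

Lemma natmin_le (P : nat -> Prop) c : P c -> natmin P <= c.
Proof.
move=> Pc; rewrite /natmin; case: pselect => // exP.
by case: ex_minnP => m _; apply; apply/asboolP.
Qed.

(** Any member [c] rules out the dummy value, so the minimum is attained. *)
Lemma natmin_in (P : nat -> Prop) c : P c -> P (natmin P).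
Proof.
move=> Pc; rewrite /natmin; case: pselect => [exP|[]].
  by case: ex_minnP => m /asboolP.
by exists c; apply/asboolP.
Qed.

End NatMin.

(** * Retrieval costs and runs in an arbitrary version graph *)

Section VersionGraphs.
Variable G : version_graph.
Local Open Scope nat_scope.

Lemma retrieval_le (X : solution G) m p v :
  retrieval_path X m p v -> retrieval X v <= path_retrieval m p.
Proof. by move=> Xmp; apply: natmin_le; exists m, p. Qed.

Lemma retrieval_attained (X : solution G) v : valid_solution X ->
  exists m p, retrieval_path X m p v /\ retrieval X v = path_retrieval m p.
Proof.
case=> _ /(_ v)[m [p Xmp]]; apply: (@natmin_in (fun c => exists m p,
  retrieval_path X m p v /\ c = path_retrieval m p) (path_retrieval m p)); by exists m, p.
Qed.

(* Every retrieval path to an unmaterialized vertex ends with a stored edge. *)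
Lemma retrieval_ge (X : solution G) c v : valid_solution X ->
  v \notin materialized X ->
  (forall u, (u, v) \in stored X -> c <= retr_cost u v) -> c <= retrieval X v.
Proof.
move=> /retrieval_attained-/(_ v)[m [p [[Mm Xp lastp] ->]]] nMv ge_c.
case/lastP: p Xp lastp => [_ /= eqm|p w]; first by rewrite -eqm Mm in nMv.
rewrite last_rcons rcons_path => /andP[_ Xw] eqw; rewrite eqw in Xw *.
rewrite /path_retrieval -cats1 pairmap_cat sumn_cat /= addn0.
by apply: leq_trans (ge_c _ Xw) _; apply: leq_addl.
Qed.

(** Inversion on the first step, used to unfold a run from a concrete tree. *)
Lemma lmg_runP S (T T'' : parent_map G) : lmg_run S T T'' ->
  (forall T', ~ lmg_step S T T') /\ T'' = T \/
  exists2 T', lmg_step S T T' & lmg_run S T' T''.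
Proof. by case=> [T1 stop|T1 T2 T3 step run]; [left | right; exists T2]. Qed.

End VersionGraphs.

(** * The bad instance and its arborescences *)

Section BadChain.
Variable n : nat.
Local Open Scope nat_scope.
Let N := n.+2.

Definition bad_chain : version_graph :=
  @VersionGraph 'I_3 (fun u v => v == u.+1 :> nat) (fun v => N ^ v)
    (fun u v => N ^ v - N ^ u) (fun u v => N ^ v - N ^ u).

Definition bad_bound : nat := 1 + (N - 1) + N ^ 2.

Local Notation G := bad_chain.

Let v0 : G := @Ordinal 3 0 isT.
Let v1 : G := @Ordinal 3 1 isT.
Let v2 : G := @Ordinal 3 2 isT.

Lemma bad_chain_case (v : G) : [\/ v = v0, v = v1 | v = v2].
Proof.
by case: v => [[|[|[|//]]] ?]; [apply: Or31|apply: Or32|apply: Or33]; apply: val_inj.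
Qed.

Lemma sum_bad_chain (F : G -> nat) : \sum_v F v = F v0 + F v1 + F v2.
Proof.
rewrite 3!big_ord_recl big_ord0 addn0 addnA.
by congr (F _ + F _ + F _); apply: val_inj.
Qed.

Lemma bad_chain_path : is_directed_path G.
Proof. by exists 2, id; split=> //; exists id. Qed.

Lemma bad_chain_single_weight : single_weight G.
Proof. by []. Qed.

(** A path has no edge bypassing two consecutive edges, and each delta cost is exactly the
    difference of the materialization costs at its ends. *)
Lemma bad_chain_triangle : triangle_inequality G.
Proof.
split=> [u v w /eqP euv /eqP euw /eqP ewv|u v _ /=]; first lia.
by rewrite -leq_subLR.
Qed.

(* The arborescences of the instance: [b] and [c] tell whether the vertices 1
   and 2 are materialized. *)
Definition chain_tree (b c : bool) : parent_map G :=
  [ffun v : G => match val v with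
                 | 0 => None
                 | 1 => if b then None else Some v0
                 | _ => if c then None else Some v1
                 end].

Lemma chain_tree0 b c : chain_tree b c v0 = None.
Proof. by rewrite ffunE. Qed.

Lemma chain_tree1 b c : chain_tree b c v1 = if b then None else Some v0.
Proof. by rewrite ffunE. Qed.

Lemma chain_tree2 b c : chain_tree b c v2 = if c then None else Some v1.
Proof. by rewrite ffunE. Qed.

Definition chain_treeE := (chain_tree0, chain_tree1, chain_tree2).

Lemma chain_tree_arborescence b c : arborescence (chain_tree b c).
Proof.
split=> v; first by case: (bad_chain_case v) => ->; rewrite chain_treeE; case: b c => [] [].
(* With three vertices, three parent steps always reach v_aux, where the iteration stays. *)
exists 3; rewrite /ancestor.
by case: (bad_chain_case v) b c => -> [] []; do ! rewrite /= ?chain_treeE.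
Qed.

(** Besides v_aux, a vertex can only have its predecessor on the path as parent, and vertex 0 has
    none. *)
Lemma arborescence_chain_tree (T : parent_map G) :
  arborescence T -> exists b c, T = chain_tree b c.
Proof.
move=> [edgeT _]; exists (T v1 == None), (T v2 == None); apply/ffunP => v.
have := edgeT v; case: (bad_chain_case v) => ->; rewrite chain_treeE;
  case: (T _) => [u|] //=; by case: (bad_chain_case u) => ->.
Qed.

Lemma chain_tree_storage b c :
  tree_storage (chain_tree b c) =
    1 + (if b then N else N - 1) + (if c then N ^ 2 else N ^ 2 - N).
Proof.
by rewrite /tree_storage sum_bad_chain !chain_treeE; case: b; case: c; rewrite /= ?expn0 ?expn1.
Qed.

Lemma chain_tree_total_retrieval b c :
  tree_total_retrieval (chain_tree b c) =
    (if b then 0 else N - 1) +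
    (if c then 0 else (if b then 0 else N - 1) + (N ^ 2 - N)).
Proof.
rewrite /tree_total_retrieval sum_bad_chain /tree_retrieval card_ord.
rewrite !big_ord_recl !big_ord0 /ancestor.
by case: b c => [] []; do ! rewrite /= ?chain_treeE; rewrite ?expn0 ?expn1; lia.
Qed.

Lemma materialize_chain_tree1 b c : materialize (chain_tree b c) v1 = chain_tree true c.
Proof. by apply/ffunP => v; rewrite ffunE; case: (bad_chain_case v) => ->; rewrite !chain_treeE. Qed.

Lemma materialize_chain_tree2 b c : materialize (chain_tree b c) v2 = chain_tree b true.
Proof. by apply/ffunP => v; rewrite ffunE; case: (bad_chain_case v) => ->; rewrite !chain_treeE. Qed.

(** * The run of LMG *)

(** Both deltas are strictly cheaper than materialization, so the initial tree is unique and no tie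
    can arise. *)
Lemma min_storage_chain_tree (T : parent_map G) :
  min_storage_arborescence T <-> T = chain_tree false false.
Proof.
split=> [[/arborescence_chain_tree[b [c ->]] minT]|->].
  have := minT _ (chain_tree_arborescence false false).
  rewrite !chain_tree_storage {minT} /N => minT.
  by case: b c minT => [] []; rewrite // !expnS expn0; nia.
split=> [|T' /arborescence_chain_tree[b [c ->]]]; first exact: chain_tree_arborescence.
by rewrite !chain_tree_storage /N; case: b c => [] []; rewrite // !expnS expn0; nia.
Qed.

(** One extra unit of storage removes the delta [N - 1] from the retrieval of both 1 and 2. *)
Lemma lmg_ratio_chain_tree1 :
  lmg_ratio (chain_tree false false) v1 = ((2 * (N%:R - 1))%:E)%R.
Proof.
rewrite /lmg_ratio materialize_chain_tree1 !chain_tree_total_retrieval chain_treeE /= expn0 expn1.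
have -> : (N%:R - (N - 1)%:R = 1 :> rat)%R by rewrite natrB //; ring.
rewrite oner_eq0 divr1 -natrB; last by lia.
congr (_%:E)%R; rewrite -(natrB _ (isT : 1 <= N)) -natrM; congr (_%:R)%R; lia.
Qed.

(** The gain is the whole path cost [N ^ 2 - 1] of vertex 2, for [N] extra units of storage. *)
Lemma lmg_ratio_chain_tree2 :
  lmg_ratio (chain_tree false false) v2 = (((N%:R ^+ 2 - 1) / N%:R)%:E)%R.
Proof.
rewrite /lmg_ratio materialize_chain_tree2 !chain_tree_total_retrieval chain_treeE /= expn1.
have leN : N <= N ^ 2 by rewrite -{1}[N]expn1 leq_exp2l.
have -> : ((N ^ 2)%:R - (N ^ 2 - N)%:R = N%:R :> rat)%R by rewrite natrB //; ring.
rewrite pnatr_eq0 /=; congr ((_ / _)%:E)%R.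
by rewrite !natrD !natrB // natrX; ring.
Qed.

Lemma lmg_ratio_chain_tree_lt :
  (lmg_ratio (chain_tree false false) v2 < lmg_ratio (chain_tree false false) v1)%E.
Proof.
rewrite lmg_ratio_chain_tree1 lmg_ratio_chain_tree2 lte_fin ltr_pdivrMr ?ltr0n //.
(* After division by [N - 1] the inequality reads [N + 1 < 2 * N]; hence the choice [N = n.+2]. *)
have : (2 <= N%:R :> rat)%R by rewrite ler_nat.
move: (N%:R : rat)%R => x; nra.
Qed.

Lemma lmg_first_step (T : parent_map G) :
  lmg_step bad_bound (chain_tree false false) T <-> T = chain_tree true false.
Proof.
have cand1 : lmg_candidate bad_bound (chain_tree false false) v1.
  rewrite /lmg_candidate chain_tree_storage chain_treeE /= /bad_bound /N !expnS expn0; nia.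
split=> [[_ [v [candv _ maxv ->]]]|->].
  case: (bad_chain_case v) candv maxv => -> candv maxv.
  - by move: candv; rewrite /lmg_candidate chain_treeE.
  - exact: materialize_chain_tree1.
  - by have := maxv _ cand1; rewrite leNgt lmg_ratio_chain_tree_lt.
split; first by rewrite chain_tree_storage /bad_bound /N !expnS expn0; nia.
exists v1; split=> //.
- rewrite lmg_ratio_chain_tree1 lte_fin mulr_gt0 // subr_gt0 ltr1n //.
- move=> w; case: (bad_chain_case w) => -> //.
    by rewrite /lmg_candidate chain_treeE.
  by move=> _; apply: ltW; apply: lmg_ratio_chain_tree_lt.
- by rewrite materialize_chain_tree1.
Qed.

(** The storage is now [N ^ 2 + 1]; adding [N] for vertex 2 exceeds the bound [N ^ 2 + N] by one. *)
Lemma lmg_no_second_step (T : parent_map G) :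
  ~ lmg_step bad_bound (chain_tree true false) T.
Proof.
case=> _ [v [candv _ _ _]]; move: candv.
rewrite /lmg_candidate chain_tree_storage.
case: (bad_chain_case v) => ->; rewrite chain_treeE //= /bad_bound /N !expnS expn0; nia.
Qed.

Lemma lmg_output_bad_chain (T : parent_map G) :
  lmg_output bad_bound T <-> T = chain_tree true false.
Proof.
split=> [[T0 /min_storage_chain_tree-> /lmg_runP[[stop _]|[T1]]]|->].
- by case: (stop (chain_tree true false)); apply/lmg_first_step.
- by move=> /lmg_first_step-> /lmg_runP[[_ ->]|[T2 /lmg_no_second_step]].
exists (chain_tree false false); first exact/min_storage_chain_tree.
apply: (lmg_continue (T' := chain_tree true false)); first exact/lmg_first_step.
by apply: lmg_stop => T'; apply: lmg_no_second_step.
Qed.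

(** * Retrieval cost of the output of LMG *)

Lemma lmg_bad_retrieval :
  N * (N - 1) <= total_retrieval (solution_of_tree (chain_tree true false)).
Proof.
(* Only the term of vertex 2 is kept: its sole stored incoming edge costs [N ^ 2 - N]. *)
rewrite /total_retrieval sum_bad_chain; apply: leq_trans (leq_addl _ _).
apply: retrieval_ge => [||u].
- split=> [[u v]|v]; rewrite ?inE /=.
    by case: (bad_chain_case v) => ->; rewrite chain_treeE //= => /eqP[<-].
  case: (bad_chain_case v) => ->.
  + by exists v0, [::]; split; rewrite // inE chain_treeE.
  + by exists v1, [::]; split; rewrite // inE chain_treeE.
  + by exists v1, [:: v2]; split; rewrite //= ?inE /= chain_treeE.
- by rewrite inE chain_treeE.
- rewrite inE /= chain_treeE => /eqP[<-] /=.
  by rewrite expn1 mulnBr muln1 mulnn.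
Qed.

(** * Bounds on the optimum *)

Definition good_solution : solution G := @Solution G [set v0; v2] [set (v0, v1)].

Lemma good_solution_valid : valid_solution good_solution.
Proof.
split=> [e|v]; first by rewrite inE => /eqP->.
case: (bad_chain_case v) => ->.
- by exists v0, [::]; split; rewrite // !inE.
- by exists v0, [:: v1]; split; rewrite //= ?inE ?eqxx.
- by exists v2, [::]; split; rewrite // !inE.
Qed.

Lemma good_solution_storage : solution_storage good_solution = bad_bound.
Proof.
rewrite /solution_storage big_setU1 ?inE //= !big_set1 /= expn0 expn1 /bad_bound.
lia.
Qed.

Lemma good_solution_retrieval : total_retrieval good_solution <= N - 1.
Proof.
rewrite /total_retrieval sum_bad_chain.
have r0 : retrieval good_solution v0 <= 0.
  by apply: (@retrieval_le _ _ v0 [::]); split; rewrite // !inE.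
have r1 : retrieval good_solution v1 <= N - 1.
  have := @retrieval_le _ good_solution v0 [:: v1] v1.
  rewrite /path_retrieval /= expn0 expn1 addn0; apply.
  by split; rewrite //= ?inE ?eqxx.
have r2 : retrieval good_solution v2 <= 0.
  by apply: (@retrieval_le _ _ v2 [::]); split; rewrite // !inE.
lia.
Qed.

Lemma opt_bad_chain_le : opt_retrieval G bad_bound <= N - 1.
Proof.
apply: leq_trans good_solution_retrieval; apply: natmin_le.
exists good_solution; split=> //; first exact: good_solution_valid.
by rewrite good_solution_storage.
Qed.

(** All edges have positive retrieval cost, so a zero total forces every vertex to be materialized,
    which costs [1 + N + N ^ 2], one unit above the bound. *)
Lemma opt_bad_chain_gt0 : 0 < opt_retrieval G bad_bound.
Proof.
(* The optimum is attained, since [good_solution] is feasible. *)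
have [X [validX storX]] : exists X : solution G, [/\ valid_solution X,
    solution_storage X <= bad_bound & opt_retrieval G bad_bound = total_retrieval X].
  apply: (@natmin_in (fun c => exists X : solution G, [/\ valid_solution X,
    solution_storage X <= bad_bound & c = total_retrieval X])
    (total_retrieval good_solution)).
  exists good_solution.
  by split=> //; [exact: good_solution_valid | rewrite good_solution_storage].
move=> ->; rewrite lt0n; apply/negP; rewrite sum_nat_eq0 => /forallP /= zeroX.
have matX v : v \in materialized X.
  apply/negPn/negP => nMv; have := zeroX v; rewrite -leqn0 leqNgt => /negP; apply.
  apply: retrieval_ge nMv _ => // u /(validX.1 (u, v)) /= /eqP ->.
  by rewrite subn_gt0 ltn_exp2l.
move: storX; rewrite /solution_storage (eq_bigl predT) //.
by rewrite sum_bad_chain /= expn0 expn1 /bad_bound /N; lia.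
Qed.

End BadChain.

Theorem theorem1 (R : realType) (alpha : R) (halpha : 1 <= alpha) :
  exists (G : version_graph) (S : nat),
    [/\ is_directed_path G, single_weight G & triangle_inequality G] /\
    [/\ (0 < opt_retrieval G S)%N,
        exists T : parent_map G, lmg_output S T
      & forall T : parent_map G, lmg_output S T ->
          alpha * (opt_retrieval G S)%:R
            < (total_retrieval (solution_of_tree T))%:R].
Proof.
have alpha_ge0 : 0 <= alpha by apply: le_trans halpha.
(* This makes [N = n.+2] larger than [alpha]. *)
pose n := Num.truncn alpha; have ltn : alpha < n.+2%:R.
  by apply: lt_trans (truncnS_gt _) _; rewrite ltr_nat.
exists (bad_chain n), (bad_bound n); split.
  split; [exact: bad_chain_path | exact: bad_chain_single_weight | exact: bad_chain_triangle].
split; first exact: opt_bad_chain_gt0.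
  by exists (chain_tree n true false); apply/lmg_output_bad_chain.
move=> T /lmg_output_bad_chain ->.
have lmg_ge : (n.+2 * (n.+2 - 1))%:R <=
    (total_retrieval (solution_of_tree (chain_tree n true false)))%:R :> R.
  by rewrite ler_nat lmg_bad_retrieval.
apply: lt_le_trans lmg_ge; rewrite natrM.
(* The optimum is at most [N - 1], and [alpha < N] stays strict after multiplication by
   [N - 1 > 0]. *)
apply: (@le_lt_trans _ _ (alpha * (n.+2 - 1)%:R)); last by rewrite ltr_pM2r ?ltr0n.
by rewrite ler_wpM2l // ler_nat opt_bad_chain_le.
Qed.
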